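(* Let $d\ge2$, let $F(x_1,\ldots,x_d)$ be a real analytic function on an open subset of $\mathbb R^d$, let $V=Z(F)$, and let $U$ be a neighbourhood of a point $p\in V$ (contained in the domain of $F$). Assume that $$\nabla F(q)\neq0\quad\text{for each } q\in U\cap V.$$ Suppose that, on $U\cap V$, the partial derivatives of $F$ admit a separated factorization $$F_{x_i}=G(x_1,\ldots,x_d)\,\alpha_{2,i}(x_i)\prod_{j\neq i}\alpha_{1,j}(x_j),\qquad i=1,\ldots,d,$$ where $G$ is analytic on $U$, and, for each $j$, the functions $\alpha_{1,j},\alpha_{2,j}$ are one-variable real analytic functions on an open interval $I_j$, with $U\subset I_1\times\cdots\times I_d$, which are not identically zero on $I_j$. Then, for every $i\in\{1,\ldots,d\}$, every local irreducible component of the boundary variety $$\Sigma_i(V)\cap U=\{q\in V\cap U: F_{x_i}(q)=0\}$$ is contained in a coordinate slice $$V_j(c)=V\cap\{x_j=c\}$$ for some $j\in\{1,\ldots,d\}$ and some constant $c\in\mathbb R$.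
   Context: Notation: $F_{x_i}=\partial F/\partial x_i$, and $Z(F)$ is the zero set of $F$ in its domain. A local irreducible component of a real analytic set $\Sigma$ means an irreducible component of the real analytic germ of $\Sigma$ at a point of $\Sigma$; containment in a slice is a local statement (containment of germs, i.e. in a sufficiently small neighbourhood of the point). The indices $j$ and the constants $c$ may differ for different local components, and $j$ need not equal $i$. *)

(* Defs.v *)
From HB Require Import structures.
From mathcomp Require Import all_boot all_order all_algebra.
From mathcomp Require Import all_classical all_reals all_analysis.
Import Order.TTheory GRing.Theory Num.Theory.
Import numFieldNormedType.Exports.

Set Implicit Arguments.
Unset Strict Implicit.
Unset Printing Implicit Defensive.

Local Open Scope classical_set_scope.
Local Open Scope ring_scope.

(* One variable: near t, f is the sum of a convergent power series centred
   at t. *)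
Definition analytic1_at (R : realType) (f : R -> R) (t : R) : Prop :=
  exists a : nat -> R,
    \forall s \near t, pseries a (s - t) @ \oo --> f s.

Definition monomial (R : realType) (d : nat) (m : {ffun 'I_d -> nat})
    (x : 'rV[R]_d) : R :=
  \prod_i x 0 i ^+ m i.

(* Several variables: near p, f is the sum of an absolutely convergent
   multi-index power series centred at p.  Absolute summability makes the sum
   independent of the order of summation; it is computed here along the boxes
   [0, N)^d of multi-indices. *)
Definition analytic_at (R : realType) (d : nat) (f : 'rV[R]_d -> R)
    (p : 'rV[R]_d) : Prop :=
  exists a : {ffun 'I_d -> nat} -> R,
    \forall x \near p,
      summable [set: {ffun 'I_d -> nat}]
        (fun m => (a m * monomial m (x - p))%:E) /\
      (fun N : nat => \sum_(k : {ffun 'I_d -> 'I_N})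
         let m := [ffun i => val (k i)] in a m * monomial m (x - p))
        @ \oo --> f x.

Definition partial_deriv (R : realType) (d : nat) (i : 'I_d)
    (F : 'rV[R]_d -> R) (x : 'rV[R]_d) : R :=
  'D_(delta_mx 0 i) F x.

Definition gradient (R : realType) (d : nat) (F : 'rV[R]_d -> R)
    (x : 'rV[R]_d) : 'rV[R]_d :=
  \row_i partial_deriv i F x.

Definition zero_set (R : realType) (d : nat) (Omega : set 'rV[R]_d)
    (F : 'rV[R]_d -> R) : set 'rV[R]_d :=
  [set x | Omega x /\ F x = 0].

(* Germs of sets at q are represented by subsets of R^d, compared only in a
   sufficiently small neighbourhood of q. *)
Definition germ_sub (R : realType) (d : nat) (q : 'rV[R]_d)
    (A B : set 'rV[R]_d) : Prop :=
  \forall x \near q, A x -> B x.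

Definition germ_eq (R : realType) (d : nat) (q : 'rV[R]_d)
    (A B : set 'rV[R]_d) : Prop :=
  \forall x \near q, A x <-> B x.

(* The germ of A at q is the common zero set of finitely many functions
   analytic at q. *)
Definition analytic_germ (R : realType) (d : nat) (q : 'rV[R]_d)
    (A : set 'rV[R]_d) : Prop :=
  exists (k : nat) (f : 'I_k -> 'rV[R]_d -> R),
    (forall l, analytic_at (f l) q) /\
    germ_eq q A [set x | forall l, f l x = 0].

Definition irreducible_germ (R : realType) (d : nat) (q : 'rV[R]_d)
    (A : set 'rV[R]_d) : Prop :=
  [/\ analytic_germ q A,
      ~ germ_eq q A set0 &
      forall B C : set 'rV[R]_d, analytic_germ q B -> analytic_germ q C ->
        germ_eq q A (B `|` C) -> germ_eq q A B \/ germ_eq q A C].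

(* A maximal irreducible analytic subgerm of the germ of S at q. *)
Definition irreducible_component_at (R : realType) (d : nat) (q : 'rV[R]_d)
    (S C : set 'rV[R]_d) : Prop :=
  [/\ irreducible_germ q C,
      germ_sub q C S &
      forall C' : set 'rV[R]_d, irreducible_germ q C' -> germ_sub q C' S ->
        germ_sub q C C' -> germ_eq q C C'].

Definition boundary_variety (R : realType) (d : nat) (i : 'I_d)
    (F : 'rV[R]_d -> R) (V : set 'rV[R]_d) : set 'rV[R]_d :=
  [set q | V q /\ partial_deriv i F q = 0].

Definition coordinate_slice (R : realType) (d : nat) (V : set 'rV[R]_d)
    (j : 'I_d) (c : R) : set 'rV[R]_d :=
  [set x | V x /\ x 0 j = c].

(* Main.v *)
Require Import Defs.
From HB Require Import structures.
From mathcomp Require Import all_boot all_order all_algebra.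
From mathcomp Require Import all_classical all_reals all_analysis.
From mathcomp Require Import lra.
Import Order.TTheory GRing.Theory Num.Theory.
Import numFieldNormedType.Exports.

Set Implicit Arguments.
Unset Strict Implicit.
Unset Printing Implicit Defensive.

Local Open Scope classical_set_scope.
Local Open Scope ring_scope.

(** Let C be a local component, at q, of the locus where F_{x_i} vanishes on V
    inside U.  Where the gradient of F is nonzero, the factor G of the
    factorization is nonzero too, since G divides every partial derivative.
    So at each point x of C near q the vanishing of F_{x_i} is due to one of
    the one-variable factors evaluated at a coordinate x_j.  The zeros of such
    a factor are isolated in I_j (analytic1_isolated_zeros), hence x_j = q_j
    for some j, possibly depending on x: near q, C is contained in the finite
    union of the coordinate hyperplanes through q.

    To obtain a single j for the whole germ, cut C by these hyperplanes one at
    a time.  Finite unions of them are zero sets of monomials in x - q, so each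
    piece of C is again an analytic germ (analytic_germ_hyperplanes), and the
    irreducibility of C forces C to equal one of the pieces
    (irreducible_germ_in_hyperplane).

    Isolation of zeros is the usual identity theorem: at each point a power
    series either has only zero coefficients or is dominated by its first
    nonzero term (pseries_leading_term), and the set of points near which the
    function vanishes is open and closed in the interval. *)

(** * Isolated zeros of one-variable analytic functions *)

Lemma geometric_sum_le2 (R : realType) (y : R) (N : nat) :
  0 <= y -> y <= 1 / 2 -> \sum_(k < N) y ^+ k <= 2.
Proof.
move=> y0 y2.
suff: \sum_(k < N) y ^+ k <= 2 - 2 * y ^+ N.
  by move/le_trans; apply; rewrite gerBl mulr_ge0 // exprn_ge0.
elim: N => [|N IH]; first by rewrite big_ord0 expr0 mulr1 subrr.
have yN : 0 <= y ^+ N by exact: exprn_ge0.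
rewrite big_ord_recr /= exprS; nra.
Qed.

(** Convergence at a single r > 0 bounds the terms a_k r^k by some M, and then
    the terms of index above n are dominated by a geometric series of
    ratio at most 1/2, whence the factor 2. *)
Lemma pseries_leading_term (R : realType) (a : nat -> R) (n : nat)
    (r M x l : R) :
  (forall k, (k < n)%N -> a k = 0) -> 0 < r ->
  (forall k, `|a k * r ^+ k| <= M) -> `|x| <= r / 2 ->
  pseries a x @ \oo --> l ->
  `|l - a n * x ^+ n| <= 2 * M * (`|x| / r) ^+ n.+1.
Proof.
move=> a0 r0 aM xr axl.
have M0 : 0 <= M by exact: le_trans (normr_ge0 _) (aM 0%N).
set y := `|x| / r.
have y0 : 0 <= y by rewrite divr_ge0 // ltW.
have y2 : y <= 1 / 2 by rewrite ler_pdivrMr // mul1r mulrC.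
have axl' : `|(pseries a x N - a n * x ^+ n)| @[N --> \oo]
    --> `|l - a n * x ^+ n|.
  by apply: cvg_norm; apply: cvgB => //; exact: cvg_cst.
rewrite -(cvg_lim (@norm_hausdorff _ _) axl').
apply: limr_le; first by apply/cvg_ex; eexists; exact: axl'.
exists n.+1 => // N /= nN.
rewrite -(subnKC nN) /pseries /series /= big_mkord big_split_ord /=.
rewrite big_ord_recr /= big1 ?add0r; last by move=> k _; rewrite a0 ?mul0r.
rewrite addrAC subrr add0r.
apply: le_trans (ler_norm_sum _ _ _) _.
apply: (@le_trans _ _ (\sum_(k < N - n.+1) M * y ^+ n.+1 * y ^+ k)).
  apply: ler_sum => k _.
  have -> : a (n.+1 + k)%N * x ^+ (n.+1 + k) =
      a (n.+1 + k)%N * r ^+ (n.+1 + k) * (x / r) ^+ (n.+1 + k).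
    by rewrite -mulrA -exprMn mulrCA divff ?mulr1 // gt_eqF.
  rewrite normrM -mulrA -exprD ler_pM // normrX normrM normfV.
  by rewrite (gtr0_norm r0).
rewrite -mulr_sumr (mulrC 2) -!mulrA ler_wpM2l // mulrC.
by rewrite ler_wpM2r ?exprn_ge0 // geometric_sum_le2.
Qed.

(** If a_n is the first nonzero coefficient, the term a_n (s - t)^n beats the
    tail, of size O(|s - t|^(n+1)), as soon as s is close enough to t. *)
Lemma analytic1_zero_dichotomy (R : realType) (f : R -> R) (t : R) :
  analytic1_at f t ->
  (\forall s \near t, f s = 0) \/ (\forall s \near t, f s = 0 -> s = t).
Proof.
move=> [a /nbhs_ballP[e /= e0 af]].
have [a0|/existsNP/cid[m am]] := pselect (forall k, a k = 0).
  left; apply/nbhs_ballP; exists e => //= s /af /(cvg_lim (@norm_hausdorff _ _)).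
  move=> <-; apply: cvg_lim => //; apply: cvg_near_cst; near=> N.
  by rewrite /pseries /series /= big1 // => k _; rewrite a0 mul0r.
right.
have exn : exists n, a n != 0 by exists m; exact/eqP.
pose n := ex_minn exn.
have [an amin] : a n != 0 /\ forall k, (k < n)%N -> a k = 0.
  rewrite /n; case: ex_minnP => k ak kmin; split => // j jk.
  by apply/eqP; apply: contraTT jk => /kmin; rewrite -leqNgt.
set r := e / 2.
have r0 : 0 < r by rewrite divr_gt0.
have [M aM] : exists M, forall k, `|a k * r ^+ k| <= M.
  have : cvgn (pseries a r).
    apply/cvg_ex; exists (f (t + r)).
    have := af (t + r); rewrite [_ + _ - _]addrAC subrr add0r; apply.
    rewrite /ball /= opprD addrA subrr add0r normrN gtr0_norm //.
    by rewrite ltr_pdivrMr // ltr_pMr // ltr1n.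
  move=> /cvg_series_cvg_0 ar0.
  have /cvg_seq_bounded : cvgn (fun k => a k * r ^+ k).
    by apply/cvg_ex; exists 0.
  move=> [M [_ /(_ (M + 1))]] aM.
  by exists (M + 1) => k; apply: aM; rewrite ?ltrDl.
have M0 : 0 <= M by exact: le_trans (normr_ge0 _) (aM 0%N).
(* Within distance min(c, r / 2) of t the tail is smaller than the leading
   term; the added 1 keeps the denominator positive when M = 0. *)
pose c := `|a n| * r ^+ n.+1 / (2 * M + 1).
have M1 : 0 < 2 * M + 1 by lra.
have c0 : 0 < c by rewrite divr_gt0 // mulr_gt0 ?normr_gt0 // exprn_gt0.
near=> s => fs0; apply/eqP; rewrite -subr_eq0; apply: contraT => st.
have x0 : 0 < `|s - t| by rewrite normr_gt0.
have xc : `|s - t| < c by rewrite distrC; near: s; apply: nbhsx_ballx.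
have xr : `|s - t| <= r / 2.
  by apply: ltW; rewrite distrC; near: s; apply: nbhsx_ballx; rewrite divr_gt0.
have axs : pseries a (s - t) @ \oo --> (0 : R).
  by rewrite -fs0; apply: af; near: s; exact: nbhsx_ballx.
have := pseries_leading_term amin r0 aM xr axs.
rewrite sub0r normrN normrM normrX expr_div_n mulrA.
rewrite ler_pdivlMr ?exprn_gt0 // (exprS `|s - t|) => le_lead.
have xn : 0 < `|s - t| ^+ n by exact: exprn_gt0.
have := xc; rewrite ltr_pdivlMr // -(ltr_pM2r xn) => lt_lead.
have := mulr_gt0 x0 xn; lra.
Unshelve. all: end_near. Qed.

(** The points near which f vanishes form an open set; by the dichotomy this
    set is also closed in J, so by connectedness it is empty as soon as f is
    nonzero somewhere on J. *)
Lemma analytic1_isolated_zeros (R : realType) (J : set R) (f : R -> R) :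
  is_interval J -> (forall t, J t -> analytic1_at f t) ->
  (exists t, J t /\ f t <> 0) ->
  forall t, J t -> \forall s \near t, f s = 0 -> s = t.
Proof.
move=> /connected_intervalP Jconn fan [t1 [Jt1 ft1]] t Jt.
have [ft|//] := analytic1_zero_dichotomy (fan t Jt); exfalso.
pose B := J `&` (f @^-1` [set 0])^°.
suff BJ : B = J.
  by move: Jt1; rewrite -BJ => -[_ /nbhs_singleton].
apply: Jconn; first by exists t; split.
- by exists (f @^-1` [set 0])^° => //; exact: open_interior.
- exists (closure B); first exact: closed_closure.
  apply/seteqP; split => [s Bs|s [Js clBs]].
    by split; [case: Bs | exact: subset_closure].
  have [fs|fs] := analytic1_zero_dichotomy (fan s Js); first by split.
  (* At an isolated zero s, a point u of B close to s would have to be s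
     itself. *)
  have [u [Bu /= fu]] := clBs _ fs.
  by rewrite -(fu (nbhs_singleton Bu.2)).
Qed.

(** * Cutting an analytic germ by coordinate hyperplanes *)

(** The power series has a single nonzero coefficient, which is inside the box
    [0, N)^d once N exceeds all exponents. *)
Lemma analytic_at_monomial (R : realType) (d : nat) (m : {ffun 'I_d -> nat})
    (q : 'rV[R]_d) :
  analytic_at (fun x => monomial m (x - q)) q.
Proof.
exists (fun k => (k == m)%:R); near=> x; split.
  rewrite /summable.
  have -> : (\esum_(k in [set: {ffun 'I_d -> nat}])
      `|((k == m)%:R * monomial k (x - q))%R%:E| =
      \esum_(k in [set m]) `|(monomial k (x - q)%R)%:E|)%E.
    rewrite [RHS]esum_mkcond; apply: eq_esum => k _.
    have [->|km] := eqVneq k m; first by rewrite mul1r mem_set.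
    by rewrite mul0r abse0 memNset // => /eqP; exact/negP.
  by rewrite esum_set1 ?abse_ge0 // ltry.
apply: cvg_near_cst.
exists (\max_i m i).+1 => // N /= mN.
have mlt i : (m i < N)%N by apply: leq_ltn_trans mN; exact: leq_bigmax.
pose k0 : {ffun 'I_d -> 'I_N} := [ffun i => Ordinal (mlt i)].
have k0m : [ffun i => val (k0 i)] = m by apply/ffunP => i; rewrite !ffunE.
rewrite (bigD1 k0) //= k0m eqxx mul1r big1 ?addr0 // => k kk0.
case: eqP => [km|]; last by rewrite mul0r.
case/eqP: kk0; apply/ffunP => i; apply: val_inj.
by rewrite -k0m in km; move/ffunP: km => /(_ i); rewrite !ffunE.
Unshelve. all: end_near. Qed.

Definition hyperplanes_through (R : realType) (d : nat) (q : 'rV[R]_d)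
    (s : seq 'I_d) : set 'rV[R]_d :=
  [set x | exists2 j, j \in s & x 0 j = q 0 j].

(** The union of the hyperplanes x_j = q_j, j in s, is the zero set of the
    product of the x_j - q_j, a monomial in x - q, whose power series at q is
    explicit. *)
Lemma hyperplanes_monomial (R : realType) (d : nat) (q x : 'rV[R]_d)
    (s : seq 'I_d) :
  hyperplanes_through q s x <->
  monomial [ffun j => count_mem j s] (x - q) = 0.
Proof.
split=> [[j js xq]|/eqP].
  apply/eqP/prodf_eq0; exists j => //.
  by rewrite ffunE !mxE xq subrr expf_eq0 eqxx andbT -has_count has_pred1.
move=> /prodf_eq0[j _]; rewrite ffunE !mxE expf_eq0 -has_count has_pred1.
by case/andP=> js; rewrite subr_eq0 => /eqP xq; exists j.
Qed.

Lemma analytic_germ_hyperplanes (R : realType) (d : nat) (q : 'rV[R]_d)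
    (C : set 'rV[R]_d) (s : seq 'I_d) :
  analytic_germ q C -> analytic_germ q (C `&` hyperplanes_through q s).
Proof.
move=> [k [f [fan Cf]]].
pose g := monomial [ffun j => count_mem j s] \o (fun x : 'rV[R]_d => x - q).
exists k.+1, (fun l => if unlift ord0 l is Some l' then f l' else g); split.
  by move=> l; case: unliftP => [l' _|_]; [exact: fan | exact: analytic_at_monomial].
rewrite /germ_eq in Cf *; near=> x.
have Cfx : C x <-> (forall l, f l x = 0) by near: x; exact: Cf.
split=> [[Cx hx] l|fgx].
  by case: unliftP => [l' _|_]; [move/Cfx: Cx | exact/hyperplanes_monomial].
split; first by apply/Cfx => l; have := fgx (lift ord0 l); rewrite liftK.
by apply/hyperplanes_monomial; have := fgx ord0; rewrite unlift_none.
Unshelve. all: end_near. Qed.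

(** Irreducibility splits off one hyperplane at a time; the list cannot run
    out, because the germ of C is not empty. *)
Lemma irreducible_germ_in_hyperplane (R : realType) (d : nat)
    (q : 'rV[R]_d) (C : set 'rV[R]_d) (s : seq 'I_d) :
  irreducible_germ q C -> germ_sub q C (hyperplanes_through q s) ->
  exists j, germ_sub q C [set x | x 0 j = q 0 j].
Proof.
rewrite /germ_sub; move=> [Can]; rewrite /germ_eq => Cn0 Cirr.
elim: s => [|j s IH] Cs.
  by case: Cn0; apply: filterS Cs => x Cx; split=> // /Cx[].
have [|||CB|CB] := Cirr (C `&` hyperplanes_through q [:: j])
    (C `&` hyperplanes_through q s);
  [exact: analytic_germ_hyperplanes|exact: analytic_germ_hyperplanes| | |].
- apply: filterS Cs => x Cx; split=> [Hx|[[]|[]]//].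
  have [l] := Cx Hx; rewrite inE => /predU1P[->|ls] xl.
    by left; split => //; exists j; rewrite ?inE.
  by right; split => //; exists l.
- exists j; apply: filterS CB => x [CBx _] /CBx[_ [l]].
  by rewrite inE => /eqP ->.
- by apply: IH; apply: filterS CB => x [CBx _] /CBx[].
Qed.

(** * Components of the boundary variety *)

Theorem theorem2p4 (R : realType) (d : nat) (hd : (2 <= d)%N)
  (Omega : set 'rV[R]_d) (hOmega : open Omega)
  (F : 'rV[R]_d -> R) (hF : forall x, Omega x -> analytic_at F x)
  (p : 'rV[R]_d) (hp : zero_set Omega F p)
  (U : set 'rV[R]_d) (hU : nbhs p U) (hUOmega : U `<=` Omega)
  (hgrad : forall q, (U `&` zero_set Omega F) q -> gradient F q <> 0)
  (G : 'rV[R]_d -> R) (hG : forall x, U x -> analytic_at G x)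
  (I : 'I_d -> set R)
  (hIopen : forall j, open (I j)) (hIint : forall j, is_interval (I j))
  (hUI : forall x, U x -> forall j, I j (x 0 j))
  (alpha1 alpha2 : 'I_d -> R -> R)
  (ha1 : forall j t, I j t -> analytic1_at (alpha1 j) t)
  (ha2 : forall j t, I j t -> analytic1_at (alpha2 j) t)
  (ha1_neq0 : forall j, exists t, I j t /\ alpha1 j t <> 0)
  (ha2_neq0 : forall j, exists t, I j t /\ alpha2 j t <> 0)
  (hfact : forall q, (U `&` zero_set Omega F) q -> forall i,
    partial_deriv i F q =
      G q * alpha2 i (q 0 i) * \prod_(j < d | j != i) alpha1 j (q 0 j)) :
  forall (i : 'I_d) (q : 'rV[R]_d) (C : set 'rV[R]_d),
    (boundary_variety i F (zero_set Omega F) `&` U) q ->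
    irreducible_component_at q
      (boundary_variety i F (zero_set Omega F) `&` U) C ->
    exists (j : 'I_d) (c : R),
      germ_sub q C (coordinate_slice (zero_set Omega F) j c).
Proof.
move=> i q C [_ Uq] [Cirr CS _].
rewrite /germ_sub; suff Cq : germ_sub q C (hyperplanes_through q (enum 'I_d)).
  have [j Cj] := irreducible_germ_in_hyperplane Cirr Cq.
  exists j, (q 0 j); move: CS Cj; rewrite /germ_sub => CS Cj.
  near=> x => Cx.
  have [[Vx _] _] : (boundary_variety i F (zero_set Omega F) `&` U) x.
    by move: Cx; near: x.
  by split=> //; move: Cx; near: x.
have isolated (a : 'I_d -> R -> R) j :
    (forall j t, I j t -> analytic1_at (a j) t) ->
    (forall j, exists t, I j t /\ a j t <> 0) ->
    \forall x \near q, a j ((x : 'rV[R]_d) 0 j) = 0 -> x 0 j = q 0 j.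
  move=> aan an0.
  have := analytic1_isolated_zeros (hIint j) (aan j) (an0 j) (hUI _ Uq j).
  exact: (@coord_continuous R 1 d 0 j q).
have iso1 : \forall x \near q, forall j,
    alpha1 j ((x : 'rV[R]_d) 0 j) = 0 -> x 0 j = q 0 j.
  have := @filter_forall _ _ (fun j (x : 'rV[R]_d) =>
    alpha1 j (x 0 j) = 0 -> x 0 j = q 0 j) (nbhs q) _.
  by apply => j; exact: isolated.
have iso2 := isolated alpha2 i ha2 ha2_neq0.
move: CS; rewrite /germ_sub => CS; near=> x => Cx.
have [[Vx Fx] Ux] : (boundary_variety i F (zero_set Omega F) `&` U) x.
  by move: Cx; near: x.
have iso1x : forall j, alpha1 j (x 0 j) = 0 -> x 0 j = q 0 j.
  by near: x; exact: iso1.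
have iso2x : alpha2 i (x 0 i) = 0 -> x 0 i = q 0 i.
  by near: x; exact: iso2.
(* Every partial derivative is a multiple of G, so G x = 0 would make the
   gradient vanish at x. *)
have Gx : G x != 0.
  apply/eqP => Gx; apply: (hgrad x (conj Ux Vx)).
  by apply/rowP => l; rewrite !mxE hfact // Gx !mul0r.
move: Fx; rewrite hfact // => /eqP; rewrite !mulf_eq0 (negbTE Gx) /=.
case/orP => [/eqP a2|/prodf_eq0[j _ /eqP a1]].
  by exists i; rewrite ?mem_enum //; apply: iso2x.
by exists j; rewrite ?mem_enum //; apply: iso1x.
Unshelve. all: end_near. Qed.
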